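(* Every connected graph $G$ with $n$ vertices and $m$ edges embeds isometrically into $\mathrm{Cay}(\mathbb{Z}_2^{n-1}, S)$ for a suitable generating set $S$ of $\mathbb{Z}_2^{n-1}$ with $|S| \leq m$.
   Context: Graphs are finite, simple and undirected; $d_G$ denotes the shortest-path distance of a connected graph $G$. A graph $G$ embeds isometrically into a graph $H$ if there is a map $\lambda: V(G)\to V(H)$ with $d_H(\lambda(u),\lambda(v))=d_G(u,v)$ for all $u,v\in V(G)$. For an abelian group $\Gamma$ (written additively) and a generating set $S\subseteq\Gamma\setminus\{0\}$ with $S=-S$ (automatic in $\mathbb{Z}_2^k$), the Cayley graph $\mathrm{Cay}(\Gamma,S)$ has vertex set $\Gamma$ and edges $\{g,g+s\}$ for $g\in\Gamma$, $s\in S$. *)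

(* Defs.v *)
From mathcomp Require Import all_boot all_fingroup all_algebra.

Set Implicit Arguments.
Unset Strict Implicit.
Unset Printing Implicit Defensive.

Import GRing.Theory.
Local Open Scope ring_scope.

Definition simple_graph (T : finType) (e : rel T) : Prop :=
  symmetric e /\ irreflexive e.

Definition connected_graph (T : finType) (e : rel T) : Prop :=
  (0 < #|T|)%N /\ forall x y : T, connect e x y.

Definition edge_set (T : finType) (e : rel T) : {set {set T}} :=
  [set [set p.1; p.2] | p : T * T & e p.1 p.2].

Definition has_walk (T : finType) (e : rel T) (x y : T) (k : nat) : bool :=
  [exists p : k.-tuple T, path e x p && (last x p == y)].

(* A shortest walk is simple, so its length is less than #|T|; the value #|T|
   is taken exactly when y is not reachable from x. *)
Definition gdist (T : finType) (e : rel T) (x y : T) : nat :=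
  \big[minn/#|T|]_(k < #|T| | has_walk e x y k) (k : nat).

Definition isometric_embedding (T U : finType) (eT : rel T) (eU : rel U)
    (f : T -> U) : Prop :=
  forall u v : T, gdist eU (f u) (f v) = gdist eT u v.

(* A finZmodType is canonically a finGroupType for +, so << S >> is the
   additive subgroup generated by S. *)
Definition cayley_gen_set (V : finZmodType) (S : {set V}) : Prop :=
  [/\ 0 \notin S, forall s, s \in S -> - s \in S & <<S>>%g = [set: V]].

Definition cayley (V : finZmodType) (S : {set V}) : rel V :=
  [rel g h | [exists s in S, h == g + s]].

Lemma gdist_le_size (T : finType) (e : rel T) (x y : T) (p : seq T) :
  path e x p -> last x p = y -> (gdist e x y <= size p)%N.
Proof.
move=> ep <-; case/shortenP: ep => q eq uq /uniq_leq_size/= sqp.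
have ltq : (size q < #|T|)%N.
  by have := max_card (mem (x :: q)); rewrite (card_uniqP uq).
apply: (@leq_trans (size q)); last first.
  by apply: sqp; have /andP[] := uq.
have wq : has_walk e x (last x q) (Ordinal ltq).
  by apply/existsP; exists (in_tuple q); rewrite eq eqxx.
rewrite /gdist; have := mem_index_enum (Ordinal ltq).
elim: (index_enum _) => // i r IHr; rewrite inE big_cons => /predU1P[<-|/IHr le].
  by rewrite wq geq_minl.
by case: ifP => // _; apply: leq_trans (geq_minr _ _) le.
Qed.

Lemma gdist_attained (T : finType) (e : rel T) (x y : T) :
  connect e x y ->
  exists p : seq T, [/\ path e x p, last x p = y & size p = gdist e x y].
Proof.
move=> /connectP[p0 ep0 y0].
have lt : (gdist e x y < #|T|)%N.
  case/shortenP: ep0 y0 => q eq uq _ yq.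
  apply: leq_ltn_trans (gdist_le_size eq (esym yq)) _.
  by have := max_card (mem (x :: q)); rewrite (card_uniqP uq).
have : gdist e x y = #|T| \/ has_walk e x y (gdist e x y).
  rewrite /gdist; elim/big_ind: _ => [|a b Ha Hb|k]; [by left| |by right].
  by rewrite /minn; case: ifP.
case=> [E|/existsP[p /andP[ep /eqP lp]]]; first by rewrite E ltnn in lt.
by exists p; rewrite size_tuple.
Qed.

Lemma cayley_simple (V : finZmodType) (S : {set V}) :
  cayley_gen_set S -> simple_graph (cayley S).
Proof.
case=> S0 SN _; split=> [g h|g].
  apply/exists_inP/exists_inP => -[s sS /eqP->]; exists (- s);
    by rewrite ?SN ?addrK.
apply/exists_inP => -[s sS /eqP/esym/eqP].
by rewrite -subr_eq0 addrC addKr => /eqP s0; rewrite -s0 sS in S0.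
Qed.

Lemma cayley_connected (V : finZmodType) (S : {set V}) :
  cayley_gen_set S -> connected_graph (cayley S).
Proof.
case=> _ _ genS; split=> [|g h]; first by apply/card_gt0P; exists 0.
have /gen_prodgP[k [c cS ghE]] : h - g \in <<S>>%g by rewrite genS inE.
have -> : h = g + \sum_(i < k) c i by rewrite -[RHS]addrC -[\sum_(i < k) _]ghE subrK.
elim: k c cS {ghE} => [|k IHk] c cS; first by rewrite big_ord0 addr0 connect0.
rewrite big_ord_recr addrA /=.
apply: connect_trans (IHk (fun i => c (widen_ord (leqnSn k) i)) _) _ => //.
by apply: connect1; apply/exists_inP; exists (c ord_max).
Qed.

(* Main.v *)
Require Import Defs.
From mathcomp Require Import all_boot all_fingroup all_algebra.

(* Send a root r to 0 and the other vertices to the standard basis, and let S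
   consist of the sums f a + f b over the edges ab.  Any map c : T -> Z_2
   induces a linear form L with L (f x) = c x - c r.  Taking for c the
   indicators of the balls of radius t < d(u,v) around u gives d(u,v) forms
   which are all nonzero on f v - f u, while at most one of them is nonzero on
   a given element of S, because d(u,-) changes by at most one along an edge.
   Hence f v - f u is not a sum of fewer than d(u,v) elements of S. *)

Set Implicit Arguments.
Unset Strict Implicit.
Unset Printing Implicit Defensive.

Import GRing.Theory.
Local Open Scope ring_scope.

Section Distance.

Variables (T : finType) (e : rel T).

Lemma gdist_refl (x : T) : gdist e x x = 0%N.
Proof. by apply/eqP; rewrite -leqn0 (@gdist_le_size _ _ _ _ [::]). Qed.

Lemma gdist_step (u a b : T) :
  connect e u a -> e a b -> (gdist e u b <= (gdist e u a).+1)%N.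
Proof.
move=> /gdist_attained[p [ep pa <-]] eab.
have := @gdist_le_size _ e u b (rcons p b).
by rewrite size_rcons last_rcons rcons_path ep pa eab => /(_ isT erefl).
Qed.

Lemma gdist_hom (U : finType) (e' : rel U) (f : T -> U) (x y : T) :
    connect e x y -> {homo f : a b / e a b >-> e' a b} ->
  (gdist e' (f x) (f y) <= gdist e x y)%N.
Proof.
move=> /gdist_attained[p [ep <- <-]] fe.
rewrite -(size_map f) gdist_le_size ?last_map //.
exact: homo_path ep.
Qed.

End Distance.

Lemma oppZ2 k (w : 'rV['Z_2]_k) : - w = w.
Proof.
apply/rowP => j; rewrite mxE; case: (w 0 j) => -[|[|]] //= i; exact: val_inj.
Qed.

Section PointedBasis.

Variables (T : finType) (k : nat) (r : T) (v : 'I_k -> T).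
Hypotheses (v_inj : injective v) (vNr : forall j, v j != r).
Hypothesis v_onto : forall x, x != r -> exists j, v j = x.

(** With [v] enumerating the vertices other than [r], no coordinate matches [r], so the root goes to
    0 without a case distinction. *)
Definition basis_vec (x : T) : 'rV['Z_2]_k := \row_j (x == v j)%:R.
Local Notation f := basis_vec.

(** As [f r = 0], a linear form cannot record [c r]; subtracting it is harmless, since on sums
    [f x + f y] only differences of [c] matter. *)
Definition cut_form (c : T -> 'Z_2) (w : 'rV['Z_2]_k) : 'Z_2 :=
  \sum_j w 0 j * (c (v j) - c r).

Lemma cut_formD c w1 w2 : cut_form c (w1 + w2) = cut_form c w1 + cut_form c w2.
Proof.
by rewrite -big_split; apply: eq_bigr => j _; rewrite mxE mulrDl.
Qed.

Lemma basis_vec_root : f r = 0.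
Proof. by apply/rowP => j; rewrite !mxE eq_sym (negPf (vNr j)). Qed.

Lemma basis_vecE j : f (v j) = delta_mx 0 j.
Proof. by apply/rowP => i; rewrite !mxE eqxx (inj_eq v_inj) eq_sym. Qed.

Lemma cut_form_basis c x : cut_form c (f x) = c x - c r.
Proof.
have [->|/v_onto[j <-]] := eqVneq x r.
  rewrite subrr; apply: big1 => j _.
  by rewrite basis_vec_root mxE mul0r.
rewrite /cut_form (bigD1 j) //= big1 ?addr0 => [|i ij].
  by rewrite mxE eqxx mul1r.
by rewrite mxE (inj_eq v_inj) eq_sym (negPf ij) mul0r.
Qed.

Lemma cut_formB c x y : cut_form c (f x + f y) = c y - c x.
Proof.
have Z2N (a : 'Z_2) : - a = a by case: a => -[|[|]] //= i; exact: val_inj.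
by rewrite cut_formD !cut_form_basis addrC -{1}[c x - _]Z2N opprB subrKA.
Qed.

Lemma basis_vec_inj : injective f.
Proof.
move=> x y fxy; apply/eqP/negPn/negP => xy.
(* The indicator of [y] gives the value 1 here, whereas equal images would have sum 0. *)
have := cut_formB (fun z => (z == y)%:R) x y.
rewrite fxy -{1}[f y]oppZ2 addNr (negPf xy) eqxx subr0 /cut_form big1 //.
by move=> j _; rewrite mxE mul0r.
Qed.

Variable e : rel T.
Hypotheses (e_simple : simple_graph e) (e_conn : forall x y, connect e x y).

(** Indexing by unordered edges makes the bound on the size of [S] immediate. *)
Definition edge_sums : {set 'rV['Z_2]_k} :=
  [set \sum_(x in A) f x | A : {set T} in edge_set e].
Local Notation S := edge_sums.

Lemma edge_sumsP (s : 'rV['Z_2]_k) :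
  reflect (exists2 p, e p.1 p.2 & s = f p.1 + f p.2) (s \in S).
Proof.
have [_ irr] := e_simple.
have sumE a b : e a b -> \sum_(x in [set a; b]) f x = f a + f b.
  move=> eab; rewrite big_setU1 ?big_set1 // inE.
  by apply: contraTneq eab => ->; rewrite irr.
apply: (iffP imsetP) => [[_ /imsetP[p + ->] ->]|[p ep ->]].
  by rewrite inE => ep; exists p; rewrite ?sumE.
exists [set p.1; p.2]; last by rewrite sumE.
by apply/imsetP; exists p; rewrite ?inE.
Qed.

Lemma card_edge_sums : (#|S| <= #|edge_set e|)%N.
Proof. exact: leq_imset_card. Qed.

Lemma cayley_edge_sums a b : e a b -> cayley S (f a) (f b).
Proof.
move=> eab; apply/exists_inP; exists (f a + f b).
  by apply/edge_sumsP; exists (a, b).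
by rewrite addrA -{2}[f a]oppZ2 subrr add0r.
Qed.

Lemma edge_sums_gen : cayley_gen_set S.
Proof.
have [_ irr] := e_simple.
split=> [|s|]; last 1 first.
- have gD w1 w2 : w1 \in <<S>>%g -> w2 \in <<S>>%g -> w1 + w2 \in <<S>>%g.
    exact: groupM.
  (* Walk from [r], where [f r = 0]: each edge adds an element of [S]. *)
  have gf x : f x \in <<S>>%g.
    have /connectP[p ep ->] := e_conn r x.
    have : f r \in <<S>>%g by rewrite basis_vec_root group1.
    elim: p r ep => //= y p IHp x0 /andP[ey ep] gx; apply: (IHp y ep).
    have /exists_inP[s sS /eqP->] := cayley_edge_sums ey.
    by apply: gD => //; apply: mem_gen.
  apply/setP => w; rewrite inE [w]row_sum_delta.
  elim/big_ind: _ => [|//|j _]; first exact: group1.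
  (* A scalar of ['Z_2] acts as a natural multiple, that is, a power in the additive group. *)
  rewrite -basis_vecE -[w 0 j]natr_Zp scaler_nat.
  exact: groupX.
- apply/edge_sumsP => -[[a b] /= eab /esym/eqP].
  rewrite addr_eq0 oppZ2 => /eqP/basis_vec_inj ab.
  by rewrite ab irr in eab.
- by rewrite oppZ2.
Qed.

Section LowerBound.

Variables u z : T.

Definition ball_ind (t : nat) (x : T) : 'Z_2 := (gdist e u x <= t)%:R.

(** On [f a + f b] this counts the balls around [u], of radius below the distance to [z], that
    contain exactly one of [a] and [b]. *)
Definition cut_weight (w : 'rV['Z_2]_k) : nat :=
  (\sum_(t < gdist e u z) (cut_form (ball_ind t) w != 0%R))%N.

Lemma cut_weightD w1 w2 :
  (cut_weight (w1 + w2) <= cut_weight w1 + cut_weight w2)%N.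
Proof.
rewrite -big_split leq_sum // => t _; rewrite cut_formD.
have [->|] := eqVneq (cut_form _ w1) 0; first by rewrite add0r.
by move=> _; rewrite (leq_trans (leq_b1 _)) ?leq_addr.
Qed.

Lemma cut_weight_edge s : s \in S -> (cut_weight s <= 1)%N.
Proof.
have [sym _] := e_simple.
case/edge_sumsP => -[a b] /= eab ->.
(* A ball of radius below [d] contains neither end of the edge; one of radius above [d] contains
   both, as the two distances differ by at most one. Only radius [d] can separate them. *)
set d := minn (gdist e u a) (gdist e u b).
have dab := gdist_step (e_conn u a) eab.
have dba : (gdist e u a <= (gdist e u b).+1)%N by rewrite gdist_step // sym.
have le t : ((cut_form (ball_ind t) (f a + f b)%R != 0%R) <= (t == d))%N.
  rewrite cut_formB subr_eq0 /ball_ind /d.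
  case: (ltngtP t (minn _ _)) => [|tgt|->]; last by case: (_ != _).
    by rewrite leq_min => /andP[]; rewrite !ltnNge => /negPf-> /negPf->; rewrite eqxx.
  have [-> ->] : (gdist e u a <= t /\ gdist e u b <= t)%N.
    move: tgt; rewrite gtn_min => /orP[] lt; split;
      by [apply: ltnW | apply: leq_trans lt].
  by rewrite eqxx.
apply: (@leq_trans (\sum_(t < gdist e u z) (nat_of_ord t == d))%N).
  by apply: leq_sum => t _; apply: le.
case: (ltnP d (gdist e u z)) => [lt|ge].
  rewrite (bigD1 (Ordinal lt)) //= eqxx big1 // => i; rewrite -val_eqE /=.
  by move/negPf->.
by rewrite big1 // => i _; rewrite ltn_eqF // (leq_trans _ ge).
Qed.

(** Modulo 2, [g + last g p] is the sum of the elements of [S] used along the walk, each of weight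
    at most 1. *)
Lemma cut_weight_path g p :
  path (cayley S) g p -> (cut_weight (g + last g p) <= size p)%N.
Proof.
elim: p g => [|h p IHp] g /=.
  rewrite -{2}[g]oppZ2 subrr => _; rewrite /cut_weight big1 // => t _.
  by rewrite /cut_form big1 ?eqxx // => j _; rewrite mxE mul0r.
case/andP => /exists_inP[s sS /eqP hE] hp.
have -> : g + last h p = s + (h + last h p).
  have sh : s + h = g by rewrite hE addrC -{2}[s]oppZ2 addrK.
    by rewrite addrA sh.
by rewrite (leq_trans (cut_weightD _ _)) // -[(size p).+1]add1n leq_add ?IHp ?cut_weight_edge.
Qed.

(** Every ball contains [u], and none contains [z], because the radii stay strictly below its
    distance. *)
Lemma cut_weight_basis : cut_weight (f u + f z) = gdist e u z.
Proof.
rewrite -[RHS]card_ord -sum1_card; apply: eq_bigr => t _.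
by rewrite cut_formB /ball_ind gdist_refl leq0n leqNgt ltn_ord mulr0n sub0r oppr_eq0 oner_eq0.
Qed.

End LowerBound.

(** Edges go to edges, so distances do not grow; conversely, the weight of [f u + f z] bounds a
    shortest walk in the Cayley graph from below. *)
Lemma basis_vec_isometric : isometric_embedding e (cayley S) f.
Proof.
move=> u z; apply/eqP; rewrite eqn_leq gdist_hom //=; last first.
  exact: cayley_edge_sums.
have [_ cS] := cayley_connected edge_sums_gen.
have [p [pp lp <-]] := gdist_attained (cS (f u) (f z)).
by rewrite -cut_weight_basis -lp cut_weight_path.
Qed.

End PointedBasis.

Theorem theorem2p5 (T : finType) (e : rel T) (n m : nat)
    (e_simple : simple_graph e) (e_connected : connected_graph e)
    (card_vertices : #|T| = n) (card_edges : #|edge_set e| = m) :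
  exists S : {set 'rV['Z_2]_(n - 1)},
    [/\ cayley_gen_set S, (#|S| <= m)%N &
        exists f : T -> 'rV['Z_2]_(n - 1),
          isometric_embedding e (cayley S) f].
Proof.
have [/card_gt0P[r _] e_conn] := e_connected.
have kE : (n - 1)%N = #|[set~ r]| by rewrite cardsC1 card_vertices subn1.
pose v (j : 'I_(n - 1)) : T := enum_val (cast_ord kE j).
have v_inj : injective v by move=> i j /enum_val_inj/cast_ord_inj.
have vNr j : v j != r by have := enum_valP (cast_ord kE j); rewrite !inE.
have v_onto x : x != r -> exists j, v j = x.
  move=> xr; have xA : x \in [set~ r] by rewrite !inE.
  exists (cast_ord (esym kE) (enum_rank_in xA x)).
  by rewrite /v cast_ordKV enum_rankK_in.
exists (edge_sums v e); split.
- exact: edge_sums_gen.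
- by rewrite -card_edges card_edge_sums.
- by exists (basis_vec v); exact: basis_vec_isometric.
Qed.
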